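(* (Soundness of LP-Unif.) Let $\Phi$ be a logic program and $A$ an atomic formula. If $\Phi\vdash\{A\}\leadsto^*_\gamma\emptyset$, then there exists a proof term $e$ with $e:\forall\underline{x}.\ \Rightarrow\gamma A$ derivable given axioms $\Phi$.
   Context: First-order terms $t ::= x \mid f(t_1,\dots,t_n)$; atomic formulas $A ::= P(t_1,\dots,t_n)$; Horn formulas $F ::= [\forall \underline{x}].\ A_1,\dots,A_n \Rightarrow A$ ($n\ge0$; for $n=0$ written $\Rightarrow A$), where $\forall\underline{x}.F$ quantifies all free term variables of $F$. Proof terms $p,e ::= \kappa \mid a \mid \lambda a.e \mid e\ e'$ ($\kappa$ proof-term constants, $a$ proof-term variables). A logic program $\Phi$ is a list $\kappa_1 : F_1,\dots,\kappa_k:F_k$ of closed Horn formulas $\forall\underline{x}. B_1,\dots,B_m\Rightarrow C$ labelled by distinct constants. Typing $e:F$ given $\Phi$ is generated by: (axiom) $\kappa:\forall\underline{x}.F$ if $(\kappa:\forall\underline{x}.F)\in\Phi$; (gen) from $e:F$ infer $e:\forall\underline{x}.F$; (inst) from $e:\forall\underline{x}.F$ infer $e:[\underline{t}/\underline{x}]F$; (cut) from $e_1:\underline{A}\Rightarrow D$ and $e_2:\underline{B},D\Rightarrow C$ infer $\lambda\underline{a}.\lambda\underline{b}.(e_2\ \underline{b})\ (e_1\ \underline{a}) : \underline{A},\underline{B}\Rightarrow C$ with $\underline{a},\underline{b}$ fresh proof-term variable lists of the lengths of $\underline{A},\underline{B}$. $A\sim_\gamma A'$ means $\gamma$ is a most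 general (idempotent) unifier: $\gamma A\equiv\gamma A'$. LP-Unif reduction: $\Phi\vdash\{A_1,\dots,A_i,\dots,A_n\}\leadsto_{\kappa,\gamma\cdot\gamma'}\{\gamma A_1,\dots,\gamma B_1,\dots,\gamma B_m,\dots,\gamma A_n\}$ (for current state $\gamma'$) whenever $\kappa:\forall\underline{x}.B_1,\dots,B_m\Rightarrow C\in\Phi$ (variables renamed apart) and $C\sim_\gamma A_i$. $\leadsto^*_\gamma$ denotes a finite reduction sequence, started with the empty substitution as state, whose final accumulated state is $\gamma$. $\forall\underline{x}.\ \Rightarrow\gamma A$ is the universal closure of $\Rightarrow\gamma A$. *)

(* Defs.v *)
From mathcomp Require Import all_boot.
From Stdlib Require List.

Set Implicit Arguments.
Unset Strict Implicit.
Unset Printing Implicit Defensive.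

Record signature := Signature {
  fsym : Type;
  farity : fsym -> nat;
  psym : Type;
  parity : psym -> nat
}.

Section Syntax.

Variable S : signature.

Inductive term :=
| Var (x : nat)
| Fun (f : fsym S) (ts : {ffun 'I_(farity f) -> term}).

Record atom := Atom {
  apred : psym S;
  aargs : {ffun 'I_(parity apred) -> term}
}.

(* The sequent A_1, ..., A_n => A, without quantifier prefix. *)
Record clause := Clause { body : seq atom; head : atom }.

(* A universal prefix always binds every variable of its matrix, so it carries
   no list of bound variables and [Forall c] is closed by construction. *)
Inductive formula :=
| Open (c : clause)
| Forall (c : clause).

(* Total maps rather than finite ones. In [inst] only the finitely many
   variables of the formula matter, and an idempotent most general unifier in
   the sense of [mgu] is the identity outside the variables of the two atoms. *)
Definition substitution := nat -> term.

Fixpoint tsubst (s : substitution) (t : term) : term :=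
  match t with
  | Var x => s x
  | Fun f ts => Fun [ffun i => tsubst s (ts i)]
  end.

Definition asubst (s : substitution) (A : atom) : atom :=
  @Atom (apred A) [ffun i => tsubst s (aargs A i)].

Definition csubst (s : substitution) (c : clause) : clause :=
  Clause (map (asubst s) (body c)) (asubst s (head c)).

(* [scomp s s'] is s . s': first s', then s. *)
Definition scomp (s s' : substitution) : substitution :=
  fun x => tsubst s (s' x).

Fixpoint tvars (t : term) : seq nat :=
  match t with
  | Var x => [:: x]
  | Fun f ts => flatten [seq tvars (ts i) | i <- enum 'I_(farity f)]
  end.

Definition avars (A : atom) : seq nat :=
  flatten [seq tvars (aargs A i) | i <- enum 'I_(parity (apred A))].

Definition gvars (G : seq atom) : seq nat := flatten (map avars G).

Definition cvars (c : clause) : seq nat := gvars (body c) ++ avars (head c).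

Definition unifier (g : substitution) (A A' : atom) : Prop :=
  asubst g A = asubst g A'.

Definition mgu (g : substitution) (A A' : atom) : Prop :=
  [/\ unifier g A A',
      forall h, unifier h A A' -> exists d, h =1 scomp d g
    & scomp g g =1 g].

End Syntax.

Arguments Var {S} x.

Inductive pterm (K : Type) :=
| PConst (k : K)
| PVar (a : nat)
| PLam (a : nat) (e : pterm K)
| PApp (e e' : pterm K).

Arguments PVar {K} a.

Fixpoint pvars (K : Type) (e : pterm K) : seq nat :=
  match e with
  | PConst _ => [::]
  | PVar a => [:: a]
  | PLam a e => a :: pvars e
  | PApp e e' => pvars e ++ pvars e'
  end.

Definition plams (K : Type) (xs : seq nat) (e : pterm K) : pterm K :=
  foldr (@PLam K) e xs.

Definition papps (K : Type) (e : pterm K) (xs : seq nat) : pterm K :=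
  foldl (@PApp K) e (map PVar xs).

(* The entry (k, c) stands for the labelled closed formula k : Forall c. *)
Record program (S : signature) (K : eqType) := Program {
  axioms : seq (K * clause S);
  labels_uniq : uniq (map fst axioms)
}.

Section LogicProgram.

Variables (S : signature) (K : eqType) (Phi : program S K).

Inductive has_type : pterm K -> formula S -> Prop :=
| ty_axiom k c :
    List.In (k, c) (axioms Phi) -> has_type (PConst k) (Forall c)
| ty_gen e c :
    has_type e (Open c) -> has_type e (Forall c)
| ty_inst e c (s : substitution S) :
    has_type e (Forall c) -> has_type e (Open (csubst s c))
| ty_cut e1 e2 As Bs D C xs ys :
    has_type e1 (Open (Clause As D)) ->
    has_type e2 (Open (Clause (Bs ++ [:: D]) C)) ->
    size xs = size As -> size ys = size Bs ->
    uniq (xs ++ ys) ->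
    {in xs ++ ys, forall a, a \notin pvars e1 ++ pvars e2} ->
    has_type (plams xs (plams ys (PApp (papps e2 ys) (papps e1 xs))))
             (Open (Clause (As ++ Bs) C)).

Definition fresh_for (x : nat) (s : substitution S) : Prop :=
  s x = Var x /\ forall y, y != x -> x \notin tvars (s y).

(* Renaming apart is taken with respect to the current goal and the
   accumulated state, i.e. everything the derivation has used so far. *)
Definition renamed_apart
    (c c' : clause S) (G : seq (atom S)) (s : substitution S) : Prop :=
  (exists2 r : nat -> nat,
     {in cvars c &, injective r} & c' = csubst (fun x => Var (r x)) c) /\
  {in cvars c', forall x, x \notin gvars G /\ fresh_for x s}.

(* [unif_step G s k G' s']: the goal G in state s reduces by k to G' in state
   s'. Goals are lists, but any position may be selected. *)
Inductive unif_step :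
    seq (atom S) -> substitution S -> K ->
    seq (atom S) -> substitution S -> Prop :=
| UnifStep G1 Ai G2 k c c' g g' :
    List.In (k, c) (axioms Phi) ->
    renamed_apart c c' (G1 ++ Ai :: G2) g' ->
    mgu g (head c') Ai ->
    unif_step (G1 ++ Ai :: G2) g' k
              (map (asubst g) (G1 ++ body c' ++ G2)) (scomp g g').

Inductive unif_steps :
    seq (atom S) -> substitution S ->
    seq (atom S) -> substitution S -> Prop :=
| UnifRefl G s : unif_steps G s G s
| UnifTrans G s k G' s' G'' s'' :
    unif_step G s k G' s' -> unif_steps G' s' G'' s'' ->
    unif_steps G s G'' s''.

Definition lp_unif (G : seq (atom S)) (g : substitution S)
    (G' : seq (atom S)) : Prop :=
  unif_steps G Var G' g.

End LogicProgram.

(* Main.v *)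
(* By induction on the reduction, the final state factors as d . s through
   each intermediate state s, and every atom A of the goal in state s has a
   proof of => d A. In the inductive step, the selected atom and the head of
   the chosen clause become equal under the unifier, so the matching instance
   of the axiom has that atom as conclusion, and its premises, which are goal
   atoms of the next state, are cut away one at a time. *)
Require Import Defs.
From mathcomp Require Import all_boot.
From Stdlib Require List.

Set Implicit Arguments.
Unset Strict Implicit.
Unset Printing Implicit Defensive.

(* The generated [term_ind] has no induction hypothesis for the arguments. *)
Fixpoint term_nested_ind (S : signature) (P : term S -> Prop)
    (HVar : forall x, P (Var x))
    (HFun : forall f (ts : {ffun 'I_(farity f) -> term S}),
        (forall i, P (ts i)) -> P (Fun ts))
    (t : term S) : P t :=
  match t with
  | Var x => HVar x
  | Fun f ts => HFun f ts (fun i => term_nested_ind HVar HFun (ts i))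
  end.

Section Substitution.

Variable S : signature.
Implicit Types (s : substitution S) (A : atom S).

Lemma eq_tsubst s s' : s =1 s' -> tsubst s =1 tsubst s'.
Proof.
move=> eq_s; elim/term_nested_ind => [x|f ts IH] /=; first exact: eq_s.
by congr Fun; apply/ffunP => i; rewrite !ffunE IH.
Qed.

Lemma tsubst_Var (t : term S) : tsubst Var t = t.
Proof.
elim/term_nested_ind: t => [//|f ts IH] /=.
by congr Fun; apply/ffunP => i; rewrite ffunE.
Qed.

Lemma tsubst_comp s s' t : tsubst (scomp s s') t = tsubst s (tsubst s' t).
Proof.
elim/term_nested_ind: t => [x|f ts IH] //=.
by congr Fun; apply/ffunP => i; rewrite !ffunE IH.
Qed.

Lemma eq_asubst s s' : s =1 s' -> asubst s =1 asubst s'.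
Proof.
move=> eq_s A; rewrite /asubst; congr Atom; apply/ffunP => i.
by rewrite !ffunE; apply: eq_tsubst.
Qed.

Lemma asubst_comp s s' A : asubst (scomp s s') A = asubst s (asubst s' A).
Proof.
by rewrite /asubst /=; congr Atom; apply/ffunP => i; rewrite !ffunE tsubst_comp.
Qed.

Lemma csubst_comp s s' (c : clause S) :
  csubst (scomp s s') c = csubst s (csubst s' c).
Proof.
rewrite /csubst /= asubst_comp -map_comp; congr Clause.
by apply: eq_map => A; exact: asubst_comp.
Qed.

End Substitution.

Lemma exists_fresh_seq (l : seq nat) (n : nat) :
  exists ys : seq nat, [/\ size ys = n, uniq ys & {in ys, forall a, a \notin l}].
Proof.
(* Consecutive numbers starting just above the maximum of [l] avoid [l]. *)
exists (iota (\max_(x <- l) x).+1 n).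
split; [exact: size_iota | exact: iota_uniq | move=> a].
rewrite mem_iota => /andP[lt_a _]; apply: contraL lt_a => al.
by rewrite -leqNgt (leq_bigmax_seq (F := id)).
Qed.

Section Soundness.

Variables (S : signature) (K : eqType) (Phi : program S K).

Definition provable (A : atom S) : Prop :=
  exists e, has_type Phi e (Open (Clause [::] A)).

(** Each premise is removed by a cut against its proof. The induction peels [Bs] from the right
    because [ty_cut] consumes the last premise. *)
Lemma provable_head (e : pterm K) (Bs : seq (atom S)) (C : atom S) :
  has_type Phi e (Open (Clause Bs C)) -> List.Forall provable Bs -> provable C.
Proof.
elim/last_ind: Bs e => [|Bs D IH] e; first by exists e.
rewrite -cats1 => tye /List.Forall_app [prBs prD].
have [e1 tye1] : provable D := List.Forall_inv prD.
have [ys [size_ys uniq_ys fresh_ys]] :=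
  exists_fresh_seq (pvars e1 ++ pvars e) (size Bs).
(* The proof of [D] has no premises, so the cut adds none and only [ys] is abstracted. *)
exact: IH (@ty_cut _ _ _ _ _ [::] _ _ _ [::] ys tye1 tye _ _ _ _) prBs.
Qed.

Lemma unif_steps_sound (G G' : seq (atom S)) (s s' : substitution S) :
  unif_steps Phi G s G' s' -> G' = [::] ->
  exists2 d, s' =1 scomp d s & List.Forall (fun A => provable (asubst d A)) G.
Proof.
elim=> {G s G' s'} [G s -> | G s k G1 s1 G' s' step _ IH /IH [d]].
  exists Var; last exact: List.Forall_nil.
  by move=> x; rewrite /scomp tsubst_Var.
case: step => {G s k G1 s1 IH} G1 Ai G2 k c c' g s kc [[r _ ->] _] [unif _ _].
(* The next state is [scomp g s]; reassociating leaves [scomp d g] as the factor over [s]. *)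
move=> eq_s' /List.Forall_map prG; exists (scomp d g).
  by move=> x; rewrite eq_s' /scomp tsubst_comp.
have{prG}: List.Forall (fun A => provable (asubst (scomp d g) A))
    (G1 ++ body (csubst (fun x => Var (r x)) c) ++ G2).
  by apply: List.Forall_impl prG => A; rewrite asubst_comp.
move=> /List.Forall_app [prG1 /List.Forall_app [prB prG2]].
apply/List.Forall_app; split=> //; apply: List.Forall_cons => //.
rewrite asubst_comp -unif -asubst_comp.
(* The axiom is stated for [c] itself, so its instance must include the renaming [r]. *)
have := ty_inst (scomp (scomp d g) (fun x => Var (r x))) (ty_axiom kc).
by rewrite csubst_comp => /provable_head; apply; apply/List.Forall_map.
Qed.

End Soundness.

Theorem theorem1 (S : signature) (K : eqType) (Phi : program S K)
    (A : atom S) (g : substitution S) :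
  lp_unif Phi [:: A] g [::] ->
  exists e : pterm K, has_type Phi e (Forall (Clause [::] (asubst g A))).
Proof.
move=> /unif_steps_sound /(_ erefl) [d eq_g prA].
have [e tye] : provable Phi (asubst d A) := List.Forall_inv prA.
(* The initial state is [Var], and [scomp d Var] is convertible to [d]. *)
by exists e; apply: ty_gen; rewrite (eq_asubst eq_g).
Qed.
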